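(* Let $P \in \mathfrak{N}_2$. Then $P$ has a 4-crown stack as a retract if and only if at least one of the following holds: (a) there is a retractive up-split $(k,U,s,t)$ of $P$, with $S=s[P(0\to k)\setminus U]$ and $T=t[P(k+1\to h_P)]$, such that $$S(h_S) < T(0) \quad\text{and}\quad \forall\, u\in U\ \exists\, v\in T(0):\ u \not< p \text{ for all } p\in t^{-1}(v);$$ (b) there is a retractive down-split $(k,D,s,t)$ of $P$, with $S=s[P(k\to h_P)\setminus D]$ and $T=t[P(0\to k-1)]$, such that $$T(h_T) < S(0) \quad\text{and}\quad \forall\, d\in D\ \exists\, v\in T(h_T):\ p \not< d \text{ for all } p\in t^{-1}(v).$$
   Context: All posets are finite. For a poset $P$ let $h_P$ be its height (maximal length of a chain, length = cardinality minus 1). The level sets are $P(0)=\min P$ and $P(k+1)=\min\big(P\setminus\bigcup_{i=0}^k P(i)\big)$ for $0\le k<h_P$. Write $P(k,\ell)=P(k)\cup P(\ell)$ and $P(k\to\ell)=\bigcup_{i=k}^{\ell}P(i)$, and identify subsets with induced subposets. For $A,B\subseteq P$, $A<B$ means $a<b$ for all $a\in A,b\in B$. A retraction of $P$ is an idempotent order-preserving map $r:P\to P$; its image $R$ (an induced subposet) is a retract, and we write $r:P\to R$. A 6-crown is a poset $x_0<y_0>x_1<y_1>x_2<y_2>x_0$ with no other comparabilities between distinct points. For antichains $A,B$ of sizes $m,n\in\{2,3\}$, ''type $mn$'' means isomorphic to the ordinal sum $A\oplus B$ (every point of $A$ below every point of $B$); type $22$ is a 4-crown. Type $3C$ means three pairwise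 disjoint 2-element chains with no further comparabilities. A 4-crown stack is a poset $Q$ of height $h_Q\ge1$ with $Q(i,i+1)$ of type $22$ for all $i\in[0,h_Q-1]$ (equivalently, an ordinal sum of $h_Q+1$ two-element antichains). A section of width three is a poset $P$ of height $h_P\ge1$ with carrier $\{c_{k,j}: k\in[0,h_P], j\in\{0,1,2\}\}$ such that: $c_{0,j}<\dots<c_{h_P,j}$ is a chain for each $j$; $\{c_{k,0},c_{k,1},c_{k,2}\}$ is an antichain for each $k$; $c_{k,i}<c_{\ell,j}$ implies $c_{k,i+1}<c_{\ell,j+1}$ (indices mod 3); and $P(k,k+1)$ is not of type $33$ for all $k\in[0,h_P-1]$. Then $P(k)=\{c_{k,0},c_{k,1},c_{k,2}\}$, and each $P(k,k+1)$ is a 6-crown or of type $3C$. Such a section is nice if for all $x<y$ in $P$ we have $\{z:z>x\}\not\subseteq\{z:z\ge y\}$ and $\{z:z<y\}\not\subseteq\{z:z\le x\}$. For a nice section $P$ of height $\ge2$, its horizon is the smallest $\eta\in\mathbb{N}$ with $P(k)<P(k+\eta)$ for all $k\in[0,h_P-\eta]$. $\mathfrak{N}_2$ denotes the class of nice sections of width three with height $\ge2$ and horizon $2$ (so $P(k)<P(\ell)$ whenever $\ell\ge k+2$, and $P(k,k+1)$ is a 6-crown or of type $3C$). Let $P\in\mathfrak N_2$. A retractive up-split of $P$ is a quadruple $(k,U,s,t)$ with $k\in[0,h_P-1]$, $U\subset P(0\to k)$, $s:P(0\to k)\setminus U\to S$ a retraction, and $t:P(k+1\to h_P)\to T$ a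 retraction, where $S$ and $T$ are each a 2-element antichain or a 4-crown stack. A retractive down-split of $P$ is a quadruple $(k,D,s,t)$ with $k\in[1,h_P]$, $D\subset P(k\to h_P)$, $s:P(k\to h_P)\setminus D\to S$ a retraction, and $t:P(0\to k-1)\to T$ a retraction, where $S,T$ are each a 2-element antichain or a 4-crown stack. Level indices $S(\cdot),T(\cdot)$ refer to the level sets of $S,T$ themselves. *)

(* Defs.v *)
(* Finite posets are finite types with a partial order
   (finPOrderType); subposets are subsets {set T} with the induced order. *)
From HB Require Import structures.
From mathcomp Require Import all_boot all_order.
Set Implicit Arguments. Unset Strict Implicit. Unset Printing Implicit Defensive.
Import Order.TTheory.

Section PosetDefs.
Context {d : Order.disp_t} {T : finPOrderType d}.

Definition chainb (C : {set T}) : bool :=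
  [forall x in C, forall y in C, (x >=< y)%O].
Definition antichainb (C : {set T}) : bool :=
  [forall x in C, forall y in C, (x != y) ==> ~~ (x >=< y)%O].
Definition height (A : {set T}) : nat :=
  (\max_(C : {set T} | (C \subset A) && chainb C) #|C|).-1.

Definition mins (A : {set T}) : {set T} :=
  [set x in A | [forall y in A, ~~ (y < x)%O]].
Fixpoint remaining (A : {set T}) (k : nat) : {set T} :=
  match k with
  | 0 => A
  | k'.+1 => remaining A k' :\: mins (remaining A k')
  end.
Definition level (A : {set T}) (k : nat) : {set T} := mins (remaining A k).
Definition levels_between (A : {set T}) (k l : nat) : {set T} :=
  \bigcup_(k <= i < l.+1) level A i.
Definition levels2 (A : {set T}) (k l : nat) : {set T} := level A k :|: level A l.

Definition lt_sets (A B : {set T}) : Prop :=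
  forall a b, a \in A -> b \in B -> (a < b)%O.

Definition is_type (m n : nat) (X : {set T}) : Prop :=
  exists A B : {set T}, [/\ X = A :|: B, #|A| = m, #|B| = n,
    antichainb A & antichainb B] /\ lt_sets A B.

Definition two_antichain (X : {set T}) : Prop := #|X| = 2 /\ antichainb X.

Definition crown_stack (Q : {set T}) : Prop :=
  1 <= height Q /\ forall i, i < height Q -> is_type 2 2 (levels2 Q i i.+1).

Definition antichain_or_stack (X : {set T}) : Prop := two_antichain X \/ crown_stack X.

Definition retraction_onto (A : {set T}) (r : T -> T) (R : {set T}) : Prop :=
  [/\ {in A, forall x, r x \in A},
      {in A, forall x, r (r x) = r x},
      {in A &, forall x y, (x <= y)%O -> (r x <= r y)%O} &
      r @: A = R].

Definition section3 : Prop :=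
  let P := [set: T] in
  let h := height P in
  1 <= h /\
  exists c : nat -> 'I_3 -> T,
  (forall k l i j, k <= h -> l <= h -> c k i = c l j -> k = l /\ i = j) /\
  [/\
(forall x, exists k i, k <= h /\ c k i = x),
      (forall k j, k < h -> (c k j < c k.+1 j)%O),
      (forall k i j, k <= h -> i != j -> ~~ (c k i >=< c k j)%O),
      (forall k l i j, k <= h -> l <= h -> (c k i < c l j)%O ->
           (c k (ordS i) < c l (ordS j))%O) &
      (forall k, k < h -> ~ is_type 3 3 (levels2 P k k.+1))].

Definition nice : Prop :=
  forall x y : T, (x < y)%O ->
    ~ ([set z | (x < z)%O] \subset [set z | (y <= z)%O]) /\
    ~ ([set z | (z < y)%O] \subset [set z | (z <= x)%O]).

Definition horizon_prop (eta : nat) : Prop :=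
  forall k, k + eta <= height [set: T] ->
    lt_sets (level [set: T] k) (level [set: T] (k + eta)).

Definition has_horizon (eta : nat) : Prop :=
  horizon_prop eta /\ forall eta', eta' < eta -> ~ horizon_prop eta'.

Definition inN2 : Prop :=
  [/\ section3, nice, 2 <= height [set: T] & has_horizon 2].

Definition up_split (k : nat) (U : {set T}) (s t : T -> T) (S Tt : {set T}) : Prop :=
  let P := [set: T] in
  k < height P /\
  [/\ U \subset levels_between P 0 k,
      retraction_onto (levels_between P 0 k :\: U) s S,
      retraction_onto (levels_between P k.+1 (height P)) t Tt,
      antichain_or_stack S & antichain_or_stack Tt].

Definition down_split (k : nat) (D : {set T}) (s t : T -> T) (S Tt : {set T}) : Prop :=
  let P := [set: T] in
  1 <= k <= height P /\
  [/\ D \subset levels_between P k (height P),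
      retraction_onto (levels_between P k (height P) :\: D) s S,
      retraction_onto (levels_between P 0 k.-1) t Tt,
      antichain_or_stack S & antichain_or_stack Tt].

Definition cond_a : Prop :=
  exists k U s t S Tt, up_split k U s t S Tt /\
    lt_sets (level S (height S)) (level Tt 0) /\
    forall u, u \in U -> exists2 v, v \in level Tt 0 &
      forall p, p \in levels_between [set: T] k.+1 (height [set: T]) ->
        t p = v -> ~~ (u < p)%O.

Definition cond_b : Prop :=
  exists k D s t S Tt, down_split k D s t S Tt /\
    lt_sets (level Tt (height Tt)) (level S 0) /\
    forall x, x \in D -> exists2 v, v \in level Tt (height Tt) &
      forall p, p \in levels_between [set: T] 0 k.-1 ->
        t p = v -> ~~ (p < x)%O.

Definition has_crown_stack_retract : Prop :=
  exists r R, retraction_onto [set: T] r R /\ crown_stack R.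

End PosetDefs.

(* Main.v *)
(** Since the horizon is 2, points whose levels differ by at least two are
    comparable.  Let [r : P -> R] be a retraction onto a 4-crown stack, [S] the
    bottom antichain of [R], [Q] the rest of [R], and [k] the highest level of
    [P] meeting [S].  Then [r] sends the levels below [k] to [S] and those above
    [k + 1] to [Q], so only the levels [k] and [k + 1] can be mixed.  If level
    [k] goes entirely to [S], removing the points of level [k + 1] which go to
    [S] yields a down-split.  Otherwise some [x0] of level [k] goes to [Q];
    sending the points of level [k + 1] that [r] puts in [S] to [r x0] instead
    makes the upper part retract to [Q], and removing the points of level [k]
    which go to [Q] yields an up-split. *)
Require Import Defs.
From mathcomp Require Import all_boot all_order.
From mathcomp Require Import zify.
Set Implicit Arguments. Unset Strict Implicit. Unset Printing Implicit Defensive.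
Import Order.TTheory.

(** * Levels and height of a subset of a finite poset *)

Section Levels.
Context {d : Order.disp_t} {T : finPOrderType d}.
Implicit Types (A C Q R : {set T}) (x y z : T).

Lemma minsP A x :
  reflect (x \in A /\ forall y, y \in A -> ~~ (y < x)%O) (x \in mins A).
Proof.
rewrite inE; apply: (iffP andP) => -[xA].
  by move/forall_inP.
by move=> h; split=> //; apply/forall_inP.
Qed.

(** Strong induction on the number of points strictly below [x]. *)
Lemma mins_below A x : x \in A -> exists2 y, y \in mins A & (y <= x)%O.
Proof.
have [n] := ubnP #|[set z | (z < x)%O]|; elim: n x => // n IHn x lxn xA.
have [xm|] := boolP (x \in mins A); first by exists x.
rewrite inE xA negb_forall_in => /exists_inP[y yA /negPn yx].
have [|z zm zy] := IHn y _ yA; last by exists z => //; apply: le_trans (ltW yx).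
apply: leq_trans (_ : #|[set z | (z < x)%O]| <= n); last by [].
apply: proper_card; apply/properP; split.
  by apply/subsetP => z; rewrite !inE => /lt_trans; apply.
by exists y; rewrite !inE // ltxx.
Qed.

Lemma remaining_sub A i j : i <= j -> remaining A j \subset remaining A i.
Proof.
move=> /subnK <-; elim: (j - i) => //= n IHn.
exact: subset_trans (subsetDl _ _) IHn.
Qed.

Lemma remaining_step A k x : x \in remaining A k.+1 ->
  exists2 y, y \in level A k & (y < x)%O.
Proof.
rewrite inE => /andP[xm xk]; have [y ym yx] := mins_below xk.
by exists y => //; rewrite lt_neqAle yx andbT; apply: contraNneq xm => <-.
Qed.

Lemma level_remaining A k x : x \in level A k -> x \in remaining A k.
Proof. by case/minsP. Qed.

Lemma level_sub A k x : x \in level A k -> x \in A.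
Proof. by move=> /level_remaining; apply/subsetP: x; apply: (remaining_sub A (leq0n k)). Qed.

Lemma level_lt A i j x y :
  x \in level A i -> y \in level A j -> (x < y)%O -> i < j.
Proof.
move=> /level_remaining xi /minsP[_ ymin] xy; rewrite ltnNge; apply/negP => ji.
by have := ymin _ (subsetP (remaining_sub A ji) _ xi); rewrite xy.
Qed.

Lemma card_chain_height A C : C \subset A -> chainb C -> #|C|.-1 <= height A.
Proof.
move=> sCA cC; rewrite /height -!subn1 leq_sub2r //.
by apply: (@leq_bigmax_cond _ _ (fun C : {set T} => #|C|)); rewrite sCA.
Qed.

(** Descending one level at a time from [x] builds a chain of [k.+1] points; the induction also
    records that [x] is its top, so that the next point can be put above it. *)
Lemma remaining_height A k x : x \in remaining A k -> k <= height A.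
Proof.
move=> xk.
suff [C [sCA cC Ck _]] : exists C : {set T},
    [/\ C \subset A, chainb C, #|C| = k.+1 & forall y, y \in C -> (y <= x)%O].
  by have := card_chain_height sCA cC; rewrite Ck.
elim: k x xk => [|k IHk] x xk.
  exists [set x]; rewrite sub1set cards1; split=> //.
    by apply/forall_inP => y /set1P->; apply/forall_inP => z /set1P->; rewrite comparablexx.
  by move=> y /set1P->.
have [y yk yx] := remaining_step xk.
have [C [sCA cC Ck Cy]] := IHk y (level_remaining yk).
have Cx z : z \in C -> (z < x)%O by move=> /Cy /le_lt_trans; apply.
have xA : x \in A := subsetP (remaining_sub A (leq0n k.+1)) _ xk.
exists (x |: C); split.
- by rewrite subUset sub1set xA.
- apply/forall_inP => u /setU1P[->|uC]; apply/forall_inP => v /setU1P[->|vC].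
  + exact: comparablexx.
  + by rewrite comparable_sym; apply/lt_comparable/Cx.
  + exact/lt_comparable/Cx.
  + exact: (forall_inP (forall_inP cC _ uC)).
- by rewrite cardsU1 Ck; case: (boolP (x \in C)) => // /Cx; rewrite ltxx.
- by move=> z /setU1P[->//|/Cx/ltW].
Qed.

(** A strictly increasing rank is injective on a chain, so every chain embeds into ['I_n.+1]. *)
Lemma height_le A (f : T -> nat) n :
  {in A &, forall x y, (x < y)%O -> f x < f y} ->
  {in A, forall x, f x <= n} -> height A <= n.
Proof.
move=> fm fn; rewrite /height -subn1 leq_subLR add1n.
apply/bigmax_leqP => C /andP[/subsetP sCA cC].
rewrite -[n.+1]card_ord -(@card_in_imset _ _ (fun x => inord (f x) : 'I_n.+1)).
  exact: max_card.
move=> x y xC yC /(congr1 (@nat_of_ord _)).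
rewrite !inordK ?ltnS ?fn ?sCA // => fxy.
have neq u v : u \in C -> v \in C -> f u = f v -> ~~ (u < v)%O.
  by move=> uC vC fuv; apply/negP => /fm; rewrite fuv ltnn !sCA // => /(_ isT isT).
have /orP[] := forall_inP (forall_inP cC _ xC) _ yC; rewrite le_eqVlt.
  by rewrite (negPf (neq x y _ _ _)) // orbF => /eqP.
by rewrite (negPf (neq y x _ _ _)) // orbF => /eqP.
Qed.

(** For [x] outside [A] the search fails and the value is [(height A).+1]. *)
Definition lev A x : nat := find (fun i => x \in level A i) (iota 0 (height A).+1).

(** A point missed by all levels up to the height would survive one removal too many for
    [remaining_height]. *)
Lemma mem_level_lev A x : x \in A -> x \in level A (lev A x).
Proof.
move=> xA; have hl : has (fun i => x \in level A i) (iota 0 (height A).+1).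
  apply/negPn/negP => /hasPn nl.
  suff /remaining_height : x \in remaining A (height A).+1 by rewrite ltnn.
  have: forall k, k <= (height A).+1 -> x \in remaining A k.
    elim=> // k IHk kh; rewrite inE IHk ?(ltnW kh) // andbT.
    by apply: nl; rewrite mem_iota.
  exact.
have := nth_find 0 hl; rewrite nth_iota //.
by rewrite -[X in _ < X](size_iota 0) -has_find.
Qed.

Lemma level_uniq A i j x : x \in level A i -> x \in level A j -> i = j.
Proof.
wlog ij : i j / i < j => [th|] xi xj.
  by case: (ltngtP i j) => // ij; [apply: th | apply/esym/th].
have := subsetP (remaining_sub A ij) _ (level_remaining xj).
by rewrite inE [x \in mins _]xi.
Qed.

Lemma in_level A i x : (x \in level A i) = (x \in A) && (lev A x == i).
Proof.
apply/idP/andP => [xi|[xA /eqP <-]]; last exact: mem_level_lev.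
have xA := level_sub xi; split=> //.
by rewrite (level_uniq (mem_level_lev xA) xi).
Qed.

Lemma lev_height A x : x \in A -> lev A x <= height A.
Proof. by move=> /mem_level_lev /level_remaining /remaining_height. Qed.

Lemma lev_lt A : {in A &, forall x y, (x < y)%O -> lev A x < lev A y}.
Proof. by move=> x y xA yA; apply: level_lt; apply: mem_level_lev. Qed.

Lemma lev_below A x i : x \in A -> i <= lev A x ->
  exists2 y, y \in level A i & (y <= x)%O.
Proof.
move=> xA; rewrite leq_eqVlt => /predU1P[->|il].
  by exists x; rewrite ?mem_level_lev.
have := level_remaining (mem_level_lev xA).
move=> /(subsetP (remaining_sub A il)) /remaining_step[y yi yx].
by exists y; rewrite ?ltW.
Qed.

Lemma in_levels_between A i j x :
  (x \in levels_between A i j) = (x \in A) && (i <= lev A x <= j).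
Proof.
rewrite /levels_between (big_morph (fun B : {set T} => x \in B) (in_setU x) (in_set0 x)).
rewrite big_has; apply/hasP/idP => [[l]|/andP[xA ij]].
  by rewrite mem_index_iota in_level => + /andP[-> /eqP->].
by exists (lev A x); rewrite ?mem_index_iota ?in_level ?xA ?eqxx.
Qed.

(** Idempotence is traded for fixing [R] pointwise, the form suited to maps glued from several
    pieces. *)
Lemma retraction_ontoP A (r : T -> T) R :
  retraction_onto A r R <->
  [/\ R \subset A, {in A, forall x, r x \in R}, {in R, forall x, r x = x} &
      {in A &, forall x y, (x <= y)%O -> (r x <= r y)%O}].
Proof.
split=> [[rA rr rm <-]|[/subsetP RA rR rid rm]]; split=> //.
- by apply/subsetP => _ /imsetP[x xA ->]; apply: rA.
- by move=> x xA; apply: imset_f.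
- by move=> _ /imsetP[x xA ->]; apply: rr.
- by move=> x xA; apply/RA/rR.
- by move=> x xA; apply/rid/rR.
- apply/setP => y; apply/imsetP/idP => [[x xA ->]|yR]; first exact: rR.
  by exists y; rewrite ?rid ?RA.
Qed.

End Levels.

(** * Ordinal sums of two-element antichains, described by a rank function *)

Section Stacks.
Context {d : Order.disp_t} {T : finPOrderType d}.
Implicit Types (A Q R S : {set T}) (x y z v w : T) (f g : T -> nat).

(* [Q] is an ordinal sum of [n.+1] two-element antichains, the fibres of [f]. *)
Definition stacked Q f n : Prop :=
  [/\ {in Q &, forall x y, (x < y)%O = (f x < f y)},
      {in Q, forall x, f x <= n} &
      forall i, i <= n -> #|[set x in Q | f x == i]| = 2].

Section StackedTheory.
Variables (Q : {set T}) (f : T -> nat) (n : nat).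
Hypothesis sQ : stacked Q f n.

Lemma stacked_fibre i : i <= n -> exists v w, [/\ v \in Q /\ f v = i, w \in Q /\ f w = i,
  v != w & {in Q, forall x, f x = i -> x = v \/ x = w}].
Proof.
case: sQ => _ _ c2 /c2 /eqP /cards2P[v [w [vw fib]]].
have vi : v \in [set x in Q | f x == i] by rewrite fib set21.
have wi : w \in [set x in Q | f x == i] by rewrite fib set22.
move: vi wi; rewrite !inE => /andP[vQ /eqP vi] /andP[wQ /eqP wi].
exists v, w; split=> // x xQ /eqP xi; apply/set2P.
by rewrite -fib inE xQ.
Qed.

Lemma stacked_other v : v \in Q -> exists w, [/\ w \in Q, f w = f v, w != v &
  {in Q, forall x, f x = f v -> x != v -> x = w}].
Proof.
case: (sQ) => _ fn _ vQ; have [a [b [[aQ fa] [bQ fb] ab abP]]] := stacked_fibre (fn _ vQ).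
have [->|->] := abP _ vQ erefl.
  exists b; split=> //; rewrite 1?eq_sym // ?fb // => x xQ; rewrite fa => /abP[] // ->.
  by rewrite eqxx.
exists a; split=> //; rewrite ?fa // => x xQ; rewrite fb => /abP[] // ->.
by rewrite eqxx.
Qed.

(** A point other than [v] either has another rank, hence is comparable to both points of the fibre
    of [v], or is [w] itself. This allows redirection to [w] whenever [v] is avoided. *)
Lemma stacked_other_le v : v \in Q -> exists w, [/\ w \in Q, f w = f v &
  {in Q, forall x, x != v -> (f v <= f x -> (w <= x)%O) /\ (f x <= f v -> (x <= w)%O)}].
Proof.
case: sQ => fm _ _ vQ; have [w [wQ fw wv wP]] := stacked_other vQ.
exists w; split=> // x xQ xv; case: (ltngtP (f v) (f x)) => vx.
- by split=> // _; rewrite ltW // fm // fw.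
- by split=> // _; rewrite ltW // fm // fw.
- by rewrite (wP x).
Qed.

(** Of the two points of the fibre at least one differs from [y], and that one is strictly below
    [y]. *)
Lemma stacked_ge_fibre y i : y \in Q -> i <= n ->
  {in Q, forall x, f x = i -> (x <= y)%O} -> i < f y.
Proof.
case: (sQ) => fm _ _ yQ /stacked_fibre[v [w [[vQ fv] [wQ fw] vw _]]] le.
have [yv|yv] := eqVneq v y.
  have : (w < y)%O by rewrite lt_neqAle le // -yv eq_sym vw.
  by rewrite fm // fw.
have : (v < y)%O by rewrite lt_neqAle le // yv.
by rewrite fm // fv.
Qed.

Lemma stacked_le_fibre y i : y \in Q -> i <= n ->
  {in Q, forall x, f x = i -> (y <= x)%O} -> f y < i.
Proof.
case: (sQ) => fm _ _ yQ /stacked_fibre[v [w [[vQ fv] [wQ fw] vw _]]] le.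
have [yv|yv] := eqVneq v y.
  have : (y < w)%O by rewrite lt_neqAle le // -yv vw.
  by rewrite fm // fw.
have : (y < v)%O by rewrite lt_neqAle le // eq_sym yv.
by rewrite fm // fv.
Qed.

(** Contrapositive of [stacked_le_fibre]; it supplies the point [v] demanded by condition (a), as
    [stacked_not_le] does for (b). *)
Lemma stacked_not_ge y i : y \in Q -> i <= f y ->
  exists v, [/\ v \in Q, f v = i & ~~ (y <= v)%O].
Proof.
move=> yQ iy; have [_ fn _] := sQ.
case: (pickP [pred v in Q | (f v == i) && ~~ (y <= v)%O]) => [v|none].
  by move=> /and3P[vQ /eqP fv yv]; exists v.
suff : f y < i by rewrite ltnNge iy.
apply: stacked_le_fibre; rewrite ?(leq_trans iy) ?fn // => v vQ fv.
by have := none v; rewrite /= vQ fv eqxx => /negbFE.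
Qed.

Lemma stacked_not_le y i : y \in Q -> f y <= i <= n ->
  exists v, [/\ v \in Q, f v = i & ~~ (v <= y)%O].
Proof.
move=> yQ /andP[yi i_n].
case: (pickP [pred v in Q | (f v == i) && ~~ (v <= y)%O]) => [v|none].
  by move=> /and3P[vQ /eqP fv yv]; exists v.
suff : i < f y by rewrite ltnNge yi.
apply: stacked_ge_fibre => // v vQ fv.
by have := none v; rewrite /= vQ fv eqxx => /negbFE.
Qed.

(** No fibre is empty, so a remaining point of rank above [k] has a point of rank [k] below it: each
    removal takes away exactly one fibre. *)
Lemma stacked_remaining k : remaining Q k = [set x in Q | k <= f x].
Proof.
have [fm fn _] := sQ.
elim: k => [|k IHk]; first by apply/setP => x; rewrite inE andbT.
apply/setP => x; rewrite /= IHk in_setD !in_set.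
have [xQ|//] := boolP (x \in Q); rewrite ?andbF //=.
have [kx|//] := leqP k (f x); last by rewrite andbF; lia.
rewrite andbT; apply/idP/idP => [|kx'].
  apply: contraR; rewrite -leqNgt => xk; apply/forall_inP => y.
  by rewrite inE => /andP[yQ ky]; rewrite fm //; lia.
have [|v [_ [[vQ fv] _ _ _]]] := @stacked_fibre k.
  by rewrite (leq_trans kx) ?fn.
rewrite negb_forall_in; apply/exists_inP; exists v.
  by rewrite inE vQ fv /=.
by rewrite negbK fm // fv.
Qed.

Lemma stacked_level k : level Q k = [set x in Q | f x == k].
Proof.
apply/setP => x.
have [fm fn _] := sQ.
rewrite /level; have -> : mins (remaining Q k) = remaining Q k :\: remaining Q k.+1.
  apply/setP => y; rewrite /= setDDr setDv set0U in_setI.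
  by rewrite andb_idl // => /minsP[].
by rewrite !stacked_remaining !inE; case: (x \in Q) => //=; lia.
Qed.

Lemma stacked_height : height Q = n.
Proof.
have [fm fn _] := sQ; apply/eqP; rewrite eqn_leq (@height_le _ _ _ f) //=; last first.
  by move=> x y xQ yQ; rewrite fm.
have [v [_ [[vQ fv] _ _ _]]] := stacked_fibre (leqnn n).
by apply: (@remaining_height _ _ _ _ v); rewrite stacked_remaining inE vQ fv leqnn.
Qed.

Lemma stacked_antichain_or_stack : antichain_or_stack Q /\ (0 < n -> crown_stack Q).
Proof.
have [fm fn c2] := sQ.
have antiL i : antichainb [set x in Q | f x == i].
  apply/forall_inP => x /[!inE]/andP[xQ /eqP fx].
  apply/forall_inP => y /[!inE]/andP[yQ /eqP fy].
  apply/implyP => xy; rewrite /Order.comparable !le_eqVlt [y == x]eq_sym (negPf xy).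
  by rewrite !fm // fx fy ltnn.
have cs : 0 < n -> crown_stack Q.
  move=> n0; split; first by rewrite stacked_height.
  move=> i; rewrite stacked_height => i_n; rewrite /levels2 !stacked_level.
  exists [set x in Q | f x == i], [set x in Q | f x == i.+1]; split.
    by split=> //; apply: c2 => //; apply: ltnW.
  by move=> x y /[!inE]/andP[xQ /eqP fx] /andP[yQ /eqP fy]; rewrite fm // fx fy.
split=> //; case: (posnP n) => [n0|/cs]; [left | by right].
have <- : [set x in Q | f x == 0] = Q.
  by apply/setP => x; rewrite inE andb_idr // => /fn; rewrite n0 leqn0.
by split; rewrite ?c2.
Qed.

End StackedTheory.

Lemma antichainbP A x y : antichainb A -> x \in A -> y \in A -> ~~ (x < y)%O.
Proof.
move=> aA xA yA; apply/negP => xy.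
have := forall_inP (forall_inP aA _ xA) _ yA.
by rewrite (lt_eqF xy) lt_comparable.
Qed.

Lemma two_antichain_stacked Q : two_antichain Q -> stacked Q (fun=> 0) 0.
Proof.
case=> c2 aQ; split=> // [x y xQ yQ|i].
  by rewrite ltnn; apply/negbTE/(antichainbP aQ).
rewrite leqn0 => /eqP->; rewrite -c2; congr #|pred_of_set _|.
by apply/setP => x; rewrite inE andbT.
Qed.

(** The summands [A] and [B] of the type are shown to be the two levels. A point of level [i] in [B]
    would have a point of [A] below it, against minimality; a point of [A] on level [i.+1] would
    have a point of level [i], hence of [A], below it. *)
Lemma type22_levels Q i : is_type 2 2 (levels2 Q i i.+1) ->
  [/\ #|level Q i| = 2, #|level Q i.+1| = 2 & lt_sets (level Q i) (level Q i.+1)].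
Proof.
case=> A [B [[QAB A2 B2 aA aB] AB]].
have memAB x : (x \in A) || (x \in B) = (x \in level Q i) || (x \in level Q i.+1).
  by rewrite -!in_setU -QAB.
have LA x : x \in level Q i -> x \in A.
  move=> xi; have := memAB x; rewrite xi /=; case: (boolP (x \in A)) => //= _ xB.
  have /card_gt0P[a aA'] : 0 < #|A| by rewrite A2.
  case/minsP: xi => _ /(_ a); rewrite AB // => h.
  suff : a \in remaining Q i by move/h.
  have := memAB a; rewrite aA' /= => /esym /orP[] /level_remaining //.
  by apply/subsetP/remaining_sub.
have eA : level Q i = A.
  apply/setP => x; apply/idP/idP => [/LA //|xA].
  have := memAB x; rewrite xA /= => /esym /orP[//|/level_remaining/remaining_step[y yi yx]].
  by have := antichainbP aA (LA _ yi) xA; rewrite yx.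
have eB : level Q i.+1 = B.
  apply/setP => x; have := memAB x; rewrite eA.
  case: (boolP (x \in A)) => [xA _|_ /= ->//].
  have -> : x \in B = false by apply/negP => /(AB _ _ xA); rewrite ltxx.
  by apply/negP => xi; rewrite -eA in xA; have := level_uniq xA xi; lia.
by rewrite eA eB.
Qed.

Lemma crown_stack_stacked Q : crown_stack Q -> stacked Q (lev Q) (height Q).
Proof.
case=> h1 h22.
have c2 i : i <= height Q -> #|level Q i| = 2.
  move=> ih; case: (ltngtP i (height Q)) => [/h22/type22_levels[]//||e]; first lia.
  (* The top level is only ever the upper half of a pair, which exists because the height is
     positive. *)
  by have [|_ + _] := @type22_levels Q i.-1 (h22 _ _); rewrite ?prednK //; lia.
(* Only consecutive levels are given as comparable; transitivity passes through a point of each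
   level between. *)
have lt_lev i j : i < j -> j <= height Q -> lt_sets (level Q i) (level Q j).
  elim: j => // j IHj; rewrite ltnS leq_eqVlt => /predU1P[->|ij] jh.
    by have [] := type22_levels (h22 _ jh).
  move=> x y xi yj.
  have /card_gt0P[z zj] : 0 < #|level Q j| by rewrite c2 // ltnW.
  apply: lt_trans (IHj ij (ltnW jh) x z xi zj) _.
  by have [_ _ +] := type22_levels (h22 _ jh); apply.
split=> [x y xQ yQ|x|i ih].
- apply/idP/idP; first exact: lev_lt.
  by move=> /lt_lev; apply; rewrite ?lev_height ?mem_level_lev.
- exact: lev_height.
- rewrite -(c2 i ih); congr #|pred_of_set _|.
  by apply/setP => x; rewrite in_level inE.
Qed.

(** The antichain is the case [n = 0], so both admissible shapes are treated alike from here on. *)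
Lemma antichain_or_stackP Q : antichain_or_stack Q <-> exists f n, stacked Q f n.
Proof.
split=> [[/two_antichain_stacked ?|/crown_stack_stacked ?]|[f [n]]]; last first.
- by case/stacked_antichain_or_stack.
- by exists (lev Q), (height Q).
- by exists (fun=> 0), 0.
Qed.

(** Every point of [S] is at or below one of top rank, and every point of [Q] is at or above one of
    level 0. *)
Lemma stacked_lt_sets S f n Q g m : stacked S f n -> stacked Q g m ->
  lt_sets (level S (height S)) (level Q 0) -> lt_sets S Q.
Proof.
move=> sS sQ SQ x y xS yQ; have [z z0 zy] := lev_below yQ (leq0n _).
apply: lt_le_trans zy; rewrite (stacked_height sS) (stacked_level sS) in SQ.
have [fm fn _] := sS; move: (fn _ xS); rewrite leq_eqVlt => /predU1P[xn|xn].
  by apply: SQ z0; rewrite inE xS xn /=.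
have [v [_ [[vS fv] _ _ _]]] := stacked_fibre sS (leqnn n).
apply: (@lt_trans _ _ v); first by rewrite fm // fv.
by apply: SQ z0; rewrite inE vS fv /=.
Qed.

Lemma stacked_sum S f n Q g m : stacked S f n -> stacked Q g m -> lt_sets S Q ->
  crown_stack (S :|: Q).
Proof.
move=> sS sQ SQ; have [fm fn f2] := sS; have [gm gn g2] := sQ.
have SQF x : x \in Q -> (x \in S) = false.
  by move=> xQ; apply/negP => xS; have := SQ x x xS xQ; rewrite ltxx.
(* The ranks of [Q] are shifted past those of [S]. The top rank [n.+1 + m] is positive, so a stack
   results even from two antichains. *)
pose h x := if x \in S then f x else n.+1 + g x.
suff /stacked_antichain_or_stack[_] : stacked (S :|: Q) h (n.+1 + m) by apply; lia.
split=> [x y /setUP[xS|xQ] /setUP[yS|yQ]|x /setUP[xS|xQ]|i i_n]; rewrite /h.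
- by rewrite xS yS fm.
- by rewrite xS SQF // SQ //; have := fn _ xS; lia.
- rewrite yS SQF //; apply/idP/idP => [xy|]; last by have := fn _ yS; lia.
  by have := lt_trans xy (SQ _ _ yS xQ); rewrite ltxx.
- by rewrite !SQF // ltn_add2l gm.
- by rewrite xS; have := fn _ xS; lia.
- by rewrite SQF // leq_add2l gn.
- case: (leqP i n) => i_n'.
    rewrite -(f2 i i_n'); congr #|pred_of_set _|; apply/setP => x; rewrite !inE.
    by case: (boolP (x \in S)) => //= _; case: (x \in Q) => //=; lia.
  rewrite -(g2 (i - n.+1)); last lia.
  congr #|pred_of_set _|; apply/setP => x; rewrite !inE.
  case: (boolP (x \in Q)) => [xQ|_] /=; first by rewrite SQF //=; lia.
  by rewrite orbF; case: (boolP (x \in S)) => //= /fn; lia.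
Qed.

End Stacks.

(** * Crown stack retracts and splits of posets with horizon 2 *)

Section Theorem6p2.
Context {d : Order.disp_t} {T : finPOrderType d}.
Hypothesis PN : @inN2 d T.
Implicit Types (x y z u v w : T).

Local Notation P := [set: T].
Local Notation lv := (lev P).

Lemma lv_lt x y : (x < y)%O -> lv x < lv y.
Proof. by apply: lev_lt; rewrite inE. Qed.

(** The horizon speaks of levels at distance exactly 2; a larger gap is reduced to this by a point
    at or below [y] on level [lv x + 2]. *)
Lemma lv_gap x y : lv x + 2 <= lv y -> (x < y)%O.
Proof.
case: PN => _ _ _ [hor _] xy; have [z z2 zy] := lev_below (in_setT y) xy.
apply: lt_le_trans zy; apply: hor z2; last by rewrite in_level inE /=.
exact: leq_trans xy (lev_height (in_setT y)).
Qed.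

Lemma in_lower k x : (x \in levels_between P 0 k) = (lv x <= k).
Proof. by rewrite in_levels_between inE. Qed.

Lemma in_upper k x : (x \in levels_between P k (height P)) = (k <= lv x).
Proof. by rewrite in_levels_between inE /= lev_height ?andbT. Qed.

(* The points of [U] are maximal in the lower part, hence can be sent to
   the bottom of [Q]: a [u] which avoids the fibre of [v] goes to the other
   point of that level. *)
Lemma cond_a_retract : @cond_a d T -> @has_crown_stack_retract d T.
Proof.
case=> k [U [s [t [S [Q [[kh [UL rs rt]]]]]]]].
move=> /antichain_or_stackP[f [n sS]] /antichain_or_stackP[g [m sQ]] [SQ0 Uv].
have SQ := stacked_lt_sets sS sQ SQ0.
move/retraction_ontoP: rs => [/subsetP SA sR sid sm].
move/retraction_ontoP: rt => [/subsetP QA tR tid tm].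
have loE x : lv x <= k -> x \notin U -> x \in levels_between P 0 k :\: U.
  by move=> xk xU; rewrite inE xU in_lower.
have upE x : k < lv x -> x \in levels_between P k.+1 (height P).
  by rewrite in_upper.
(* Since [t] fixes [v], the condition at [p = v] says that [u] is not below [v]. As [v] lies above
   level [k], [lv_gap] leaves only level [k] for [u]. *)
have lvU u : u \in U -> lv u = k.
  move=> uU; have := subsetP UL u uU; rewrite in_lower => uk.
  have [v v0 vP] := Uv u uU; have vQ := level_sub v0.
  have := vP v (QA _ vQ) (tid _ vQ); have := QA _ vQ; rewrite in_upper => kv.
  by apply: contraNeq => uk'; apply: lv_gap; lia.
(* A good [w] is a possible image of [u]: a lower bound of all that monotonicity forces above it.
   The default in [wu] is never reached on [U], by [wuP]. *)
pose good u w := (w \in Q) && [forall p, (k < lv p) && (u < p)%O ==> (w <= t p)%O].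
pose wu u := odflt u [pick w | good u w].
have wuP u : u \in U -> good u (wu u).
  move=> uU; rewrite /wu; case: pickP => //= none.
  have [v v0 vP] := Uv u uU; move: v0; rewrite (stacked_level sQ) inE => /andP[vQ /eqP gv].
  have [w [wQ _ wP]] := stacked_other_le sQ vQ.
  have := none w; rewrite /good wQ /= => /negP[].
  apply/forallP => p; apply/implyP => /andP[kp up].
  have [//||le _] := wP (t p); first exact/tR/upE.
    by apply/eqP => /(vP p (upE p kp)); rewrite up.
  by apply: le; rewrite gv.
pose r x := if k < lv x then t x else if x \in U then wu x else s x.
have rR x : r x \in S :|: Q.
  rewrite /r inE; case: leqP => kx; last by rewrite tR ?orbT ?upE.
  case: (boolP (x \in U)) => xU; last by rewrite sR ?loE.
  by have /andP[-> _] := wuP x xU; rewrite orbT.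
exists r, (S :|: Q); split; last exact: stacked_sum sS sQ SQ.
apply/retraction_ontoP; split=> // [|x y _ _].
- move=> x /setUP[xS|xQ]; rewrite /r.
    have := SA x xS; rewrite inE in_lower => /andP[xU xk].
    by rewrite ltnNge xk /= (negPf xU) sid.
  by have := QA x xQ; rewrite in_upper => ->; rewrite tid.
- rewrite le_eqVlt => /predU1P[->//|xy]; have lxy := lv_lt xy.
  rewrite /r; have [kx|kx] := leqP (lv x) k; last first.
    rewrite (ltn_trans kx lxy); apply: tm (ltW xy); first exact: upE.
    exact/upE/(ltn_trans kx).
  (* Points of [U] are on level [k], so anything above them is mapped by [t] and [good] applies. *)
  case: (boolP (x \in U)) => xU.
    have := lvU x xU => xk; have ky : k < lv y by rewrite -xk.
    by have /andP[_ /forallP/(_ y)] := wuP x xU; rewrite ky xy.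
  have sx : s x \in S by rewrite sR ?loE.
  have [ky|ky] := leqP (lv y) k; last by rewrite ltW // SQ ?tR ?upE.
  case: (boolP (y \in U)) => yU; last by apply: sm (ltW xy); apply: loE.
  by have /andP[wQ _] := wuP y yU; rewrite ltW // SQ.
Qed.

(** Order dual of the previous argument: the points of [D] are minimal in the upper part and can be
    sent to the top level of [Q], which now lies below [S]. *)
Lemma cond_b_retract : @cond_b d T -> @has_crown_stack_retract d T.
Proof.
case=> k [D [s [t [S [Q [[/andP[k0 kh] [DL rs rt]]]]]]]].
move=> /antichain_or_stackP[f [n sS]] /antichain_or_stackP[g [m sQ]] [QS0 Dv].
have QS := stacked_lt_sets sQ sS QS0.
move/retraction_ontoP: rs => [/subsetP SA sR sid sm].
move/retraction_ontoP: rt => [/subsetP QA tR tid tm].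
have [_ gn _] := sQ.
have upE x : k <= lv x -> x \notin D -> x \in levels_between P k (height P) :\: D.
  by move=> xk xD; rewrite inE xD in_upper.
have loE x : lv x < k -> x \in levels_between P 0 k.-1.
  by rewrite in_lower; lia.
(* Here [k0] matters: it makes [k.-1] strictly smaller than [k], leaving a gap of two between [v]
   and a point above level [k]. *)
have lvD u : u \in D -> lv u = k.
  move=> uD; have := subsetP DL u uD; rewrite in_upper => uk.
  have [v v0 vP] := Dv u uD; have vQ := level_sub v0.
  have := vP v (QA _ vQ) (tid _ vQ); have := QA _ vQ; rewrite in_lower => kv.
  by apply: contraNeq => uk'; apply: lv_gap; lia.
pose good u w := (w \in Q) && [forall p, (lv p < k) && (p < u)%O ==> (t p <= w)%O].
pose wu u := odflt u [pick w | good u w].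
have wuP u : u \in D -> good u (wu u).
  move=> uD; rewrite /wu; case: pickP => //= none.
  have [v v0 vP] := Dv u uD; move: v0.
  rewrite (stacked_level sQ) (stacked_height sQ) inE => /andP[vQ /eqP gv].
  have [w [wQ _ wP]] := stacked_other_le sQ vQ.
  have := none w; rewrite /good wQ /= => /negP[].
  apply/forallP => p; apply/implyP => /andP[kp up].
  have tpQ : t p \in Q by exact/tR/loE.
  have [//||_ le] := wP (t p).
    by apply/eqP => /(vP p (loE p kp)); rewrite up.
  by apply: le; rewrite gv gn.
pose r x := if lv x < k then t x else if x \in D then wu x else s x.
have rR x : r x \in Q :|: S.
  rewrite /r inE; case: leqP => kx; last by rewrite tR ?loE.
  case: (boolP (x \in D)) => xD; last by rewrite sR ?upE ?orbT.
  by have /andP[-> _] := wuP x xD.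
exists r, (Q :|: S); split; last exact: stacked_sum sQ sS QS.
apply/retraction_ontoP; split=> // [|x y _ _].
- move=> x /setUP[xQ|xS]; rewrite /r.
    have xk : lv x < k by have := QA x xQ; rewrite in_lower; lia.
    by rewrite xk tid.
  have := SA x xS; rewrite inE in_upper => /andP[xD xk].
  by rewrite ltnNge xk /= (negPf xD) sid.
- rewrite le_eqVlt => /predU1P[->//|xy]; have lxy := lv_lt xy.
  rewrite /r; have [ky|ky] := leqP k (lv y); last first.
    rewrite (ltn_trans lxy ky); apply: tm (ltW xy); last exact: loE.
    exact/loE/(ltn_trans lxy).
  case: (boolP (y \in D)) => yD.
    have := lvD y yD => yk; have kx : lv x < k by rewrite -yk.
    by have /andP[_ /forallP/(_ x)] := wuP y yD; rewrite kx xy.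
  have sy : s y \in S by rewrite sR ?upE.
  have [kx|kx] := leqP k (lv x); last by rewrite ltW // QS ?tR ?loE.
  case: (boolP (x \in D)) => xD; last by apply: sm (ltW xy); apply: upE.
  by have /andP[wQ _] := wuP x xD; rewrite ltW // QS.
Qed.

Lemma retract_cond : @has_crown_stack_retract d T -> @cond_a d T \/ @cond_b d T.
Proof.
case=> r [R [/retraction_ontoP[_ rR rid rm] cR]].
have sR := crown_stack_stacked cR; have [fm fn f2] := sR.
have [n0 _] := cR; move: (lev R) (height R) sR fm fn f2 n0 => f n sR fm fn f2 n0 {cR}.
have {}rR x : r x \in R by rewrite rR.
have {}rm x y : (x <= y)%O -> (r x <= r y)%O by apply: rm; rewrite inE.
have fle x y : x \in R -> y \in R -> (x <= y)%O -> f x <= f y.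
  by move=> xR yR; rewrite le_eqVlt => /predU1P[->//|]; rewrite fm // => /ltnW.
pose S := [set x in R | f x == 0]; pose Q := [set x in R | 0 < f x].
have sS : stacked S f 0.
  split=> [x y|x|i]; first by rewrite !inE => /andP[xR _] /andP[yR _]; rewrite fm.
    by rewrite inE => /andP[_ /eqP->].
  rewrite leqn0 => /eqP->; rewrite -(f2 0) //; congr #|pred_of_set _|.
  by apply/setP => x; rewrite !inE -andbA andbb.
(* Rank 0 has been removed, so ranks drop by one; [n0] ensures that rank 1 is present. *)
have sQ : stacked Q (fun x => (f x).-1) n.-1.
  split=> [x y|x|i i_n].
  - by rewrite !inE => /andP[xR fx] /andP[yR fy]; rewrite fm //; lia.
  - by rewrite inE => /andP[/fn fx _]; lia.
  - rewrite -(f2 i.+1); last lia.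
    congr #|pred_of_set _|; apply/setP => x; rewrite !inE.
    by case: (x \in R) => //=; lia.
have SQ : lt_sets S Q.
  by move=> x y /[!inE] /andP[xR /eqP fx] /andP[yR fy]; rewrite fm // fx.
have topS : level S (height S) = S.
  by apply/setP => x; rewrite (stacked_height sS) (stacked_level sS) !inE -andbA andbb.
have [a [_ [[aR fa] _ _ _]]] := stacked_fibre sR (leq0n n).
have aS : a \in S by rewrite inE aR fa.
have [b bS bmax] := @arg_maxnP _ a (mem S) (fun x => lv x) aS.
set k := lv b.
have Slv x : x \in S -> lv x <= k by apply: bmax.
have Qlv x : x \in Q -> k < lv x by move=> xQ; apply/lv_lt/SQ.
have rS x : f (r x) = 0 -> r x \in S by move=> h; rewrite inE rR h /=.
have rQ x : 0 < f (r x) -> r x \in Q by move=> h; rewrite inE rR h.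
(* Points of [Q] lie above level [k], hence above [x] by [lv_gap]. Applying [r], which fixes them,
   puts [r x] below both points of rank 1, so its rank is 0. Dually for [high], with the points of
   [S]. *)
have low x : lv x < k -> f (r x) = 0.
  move=> xk; apply/eqP; rewrite -leqn0 -ltnS.
  apply: (stacked_le_fibre sR) => // y yR fy.
  rewrite -(rid y yR) rm // ltW // lv_gap //.
  have : y \in Q by rewrite inE yR fy.
  by move/Qlv; lia.
have high x : k.+1 < lv x -> 0 < f (r x).
  move=> xk; apply: (stacked_ge_fibre sR) => // y yR fy.
  rewrite -(rid y yR) rm // ltW // lv_gap //.
  have : y \in S by rewrite inE yR fy.
  by move/Slv; lia.
have lv_h x : lv x <= height P by rewrite lev_height.
have [c [_ [[cR fc] _ _ _]]] := stacked_fibre sR n0.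
have kh : k < height P by apply: leq_trans (lv_h c); apply: Qlv; rewrite inE cR fc.
case: (pickP (fun x => (lv x == k) && (0 < f (r x)))) => [x0 /andP[/eqP x0k fx0]|none].
  left.
  (* Every point of level at least [k + 2] lies above [x0], so the points of
     level [k + 1] that [r] sends to [S] may be redirected to [r x0]. *)
  pose t y := if 0 < f (r y) then r y else r x0.
  have tQ y : t y \in Q by rewrite /t; case: ifP => ?; apply: rQ.
  exists k, [set x | (lv x <= k) && (0 < f (r x))], r, t, S, Q; split; last split.
  - split=> //; split.
    + by apply/subsetP => x; rewrite inE in_lower => /andP[].
    + apply/retraction_ontoP; split=> [|x|x|x y _ _]; last exact: rm.
      * apply/subsetP => x xS; rewrite in_setD in_lower Slv // inE andbT.
        by move: xS; rewrite inE => /andP[xR /eqP fx]; rewrite rid // fx andbF.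
      * by rewrite !in_setD inE in_lower => /andP[+ xk]; rewrite xk /= => fx; apply: rS; lia.
      * by rewrite inE => /andP[xR _]; rewrite rid.
    + apply/retraction_ontoP; split=> [|x|x|x y].
      * by apply/subsetP => x /Qlv; rewrite in_upper.
      * by rewrite tQ.
      * by rewrite inE => /andP[xR fx]; rewrite /t rid // fx.
      * rewrite !in_upper le_eqVlt => kx ky /predU1P[->//|xy]; have lxy := lv_lt xy.
        rewrite /t (high y); last by apply: leq_ltn_trans lxy.
        by case: ifP => _; rewrite rm ?(ltW xy) // ltW // lv_gap //; lia.
    + by apply/antichain_or_stackP; exists f, 0.
    + by apply/antichain_or_stackP; exists (fun x => (f x).-1), n.-1.
  - by rewrite topS => x y xS /level_sub; apply: SQ.
  - move=> u; rewrite inE => /andP[uk fu].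
    (* Rank 1 in [R] is the bottom level of [Q]. *)
    have [v [vR fv nv]] := stacked_not_ge sR (rR u) fu.
    exists v; first by rewrite (stacked_level sQ) !inE vR fv.
    (* If [u < p] then [r p] is above [r u], so it lies in [Q] and [p] was not redirected:
       [t p = r p], whence [r u <= v]. *)
    move=> p _ tp; apply: contra nv => /ltW/rm up.
    by rewrite -tp /t (leq_trans fu) // fle.
right.
have low' x : lv x <= k -> f (r x) = 0.
  rewrite leq_eqVlt => /predU1P[xk|/low//]; have := none x; rewrite xk eqxx /=; lia.
(* The split starts at level [k.+1] because all levels up to [k] go to [S]. Both retractions are
   restrictions of [r], the upper one onto [Q] and the lower one onto [S]. *)
exists k.+1, [set x | (k < lv x) && (f (r x) == 0)], r, r, Q, S; split; last split.
- split; first by rewrite kh.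
  split.
  + by apply/subsetP => x; rewrite inE in_upper => /andP[].
  + apply/retraction_ontoP; split=> [|x|x|x y _ _]; last exact: rm.
    * apply/subsetP => x xQ; rewrite in_setD in_upper Qlv // inE andbT.
      by move: xQ; rewrite inE => /andP[xR fx]; rewrite rid // negb_and -lt0n fx orbT.
    * by rewrite in_setD inE in_upper => /andP[+ xk]; rewrite xk /= -lt0n => /rQ.
    * by rewrite inE => /andP[xR _]; rewrite rid.
  + apply/retraction_ontoP; split=> [|x|x|x y _ _]; last exact: rm.
    * by apply/subsetP => x /Slv; rewrite in_lower.
    * by rewrite in_lower => /low'/rS.
    * by rewrite inE => /andP[xR _]; rewrite rid.
  + by apply/antichain_or_stackP; exists (fun x => (f x).-1), n.-1.
  + by apply/antichain_or_stackP; exists f, 0.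
- by rewrite topS => x y xS /level_sub; apply: SQ.
- move=> u; rewrite inE topS => /andP[uk /eqP fu].
  (* As [r u] is itself in [S], the witness [v] is the other point of [S]; some [p < u] with
     [r p = v] would give [v <= r u]. *)
  have [|v [vR fv nv]] := @stacked_not_le _ _ _ _ _ sR (r u) 0 (rR u); first by rewrite fu.
  exists v; first by rewrite inE vR fv.
  by move=> p _ rp; apply: contra nv => /ltW/rm; rewrite rp.
Qed.

End Theorem6p2.

Theorem theorem6p2 (d : Order.disp_t) (T : finPOrderType d) :
  @inN2 d T ->
  (@has_crown_stack_retract d T <-> (@cond_a d T \/ @cond_b d T)).
Proof.
move=> PN; split; first exact: retract_cond PN.
by case; [apply: cond_a_retract | apply: cond_b_retract].
Qed.
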